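(* Let $X_{n,m}$ be the number of remaining single-unit pills at the moment when all double-unit pills have been taken, in the pills urn process started with $m\ge 1$ double-unit pills and $n\ge 0$ single-unit pills. Let $h_{n,m}(v):=\sum_{k\ge 0}\mathbb{P}\{X_{n,m}=k\}\,v^{k}$ be its probability generating function. Then: (i) For all integers $n\ge 0$, $m\ge 1$, $$h_{n,m}(v)=m v\int_{0}^{1}\bigl(1+(v-1)q\bigr)^{n}\bigl(1-q-(v-1)q\log q\bigr)^{m-1}\,dq .$$ (ii) If $m\to\infty$ (with $n=n(m)\ge 0$ an arbitrary sequence of integers), then $$\frac{X_{n,m}}{\frac{n}{m}+\log m}\xrightarrow{(d)}X,$$ where $X$ is exponentially distributed with parameter $1$, i.e. has density $e^{-x}$ for $x\ge 0$. (iii) If $m\ge 1$ is fixed and $n\to\infty$, then $$\frac{X_{n,m}}{n}\xrightarrow{(d)}B_{m},$$ where $B_{m}$ is $\mathrm{Beta}(1,m)$-distributed, i.e. has density $m(1-x)^{m-1}$ for $0\le x\le 1$.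
   Context: Pills urn process: the state is $(m,n)$, where $m$ is the number of double-unit pills and $n$ the number of single-unit pills in the urn. At every step a pill is picked uniformly at random from the $m+n$ pills. If it is a single-unit pill (probability $\frac{n}{m+n}$), it is eaten, and the state becomes $(m,n-1)$. If it is a double-unit pill (probability $\frac{m}{m+n}$), it is broken into two halves, one is eaten and the other is put back as a single-unit pill, so the state becomes $(m-1,n+1)$. The process stops when no double-unit pills are left, i.e. at a state $(0,k)$; then $X_{n,m}=k$. Equivalently, $h_{n,m}(v)=\frac{n}{n+m}h_{n-1,m}(v)+\frac{m}{n+m}h_{n+1,m-1}(v)$ for $n\ge 0$, $m\ge 1$, with $h_{n,0}(v)=v^{n}$. The symbol $\xrightarrow{(d)}$ denotes convergence in distribution. The function $h_{n,m}$ is a polynomial in $v$, and (i) is an identity of polynomials in $v$. *)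

(* Defs.v *)
(* MathComp-Analysis *)
From HB Require Import structures.
From mathcomp Require Export all_boot all_order all_algebra.
From mathcomp Require Export all_classical all_reals all_analysis.
Export Order.TTheory GRing.Theory Num.Theory.
Export numFieldNormedType.Exports.

Set Implicit Arguments.
Unset Strict Implicit.
Unset Printing Implicit Defensive.

Local Open Scope classical_set_scope.
Local Open Scope ring_scope.

(* One step of the urn. A state is the pair (m, n) of the number m of
   double-unit pills and the number n of single-unit pills. States (0, k) are
   absorbing: this represents the stopped process by a process indexed by all
   of nat. For n = 0 the first term has weight 0, so 0.-1 does not matter. *)
Definition pill_step (R : realType) (s s' : nat * nat) : R :=
  let: (m, n) := s in
  if m == 0%N then (s' == s)%:R
  else n%:R / (m + n)%:R * (s' == (m, n.-1))%:R
       + m%:R / (m + n)%:R * (s' == (m.-1, n.+1))%:R.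

Section PillsProcess.
Context d (T : measurableType d) (R : realType) (P : probability T R).

(* S is a Markov chain started at (m, n) with transition matrix pill_step; the
   Markov property is stated through the probabilities of finite paths. *)
Definition pills_process (m n : nat) (S : nat -> {RV P >-> (nat * nat)%type})
    : Prop :=
  P [set w | S 0%N w = (m, n)] = 1%E /\
  forall (t : nat) (s : nat -> nat * nat),
    P [set w | forall i, (i <= t.+1)%N -> S i w = s i] =
    (P [set w | forall i, (i <= t)%N -> S i w = s i]
     * (pill_step R (s t) (s t.+1))%:E)%E.

(* The number of single-unit pills at the first time without double-unit pills.
   The value 0 on the (negligible) event where this never happens is junk. *)
Definition remaining (S : nat -> {RV P >-> (nat * nat)%type}) (w : T) : nat :=
  if pselect (exists t, (S t w).1 == 0%N) is left h
  then (S (ex_minn h) w).2 else 0%N.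

Lemma measurable_remaining S : measurable_fun setT (remaining S).
Proof.
pose F t := [set w | (S t w).1 = 0%N].
have mS t (A : set (nat * nat)) : measurable A -> measurable (S t @^-1` A).
  by move=> mA; rewrite -[X in measurable X]setTI; exact: measurable_funPT.
have mF t : measurable (F t).
  have := mS t (fst @^-1` [set 0%N]); apply.
  by rewrite -[X in measurable X]setTI; exact: measurable_fst.
pose G t := F t `\` \bigcup_(i in `I_t) F i.
have mG t : measurable (G t).
  by apply: measurableD => //; apply: bigcup_measurable.
move=> _ A _; rewrite setTI.
have -> : remaining S @^-1` A =
    \bigcup_t (G t `&` S t @^-1` (snd @^-1` A))
    `|` ((~` (\bigcup_t F t)) `&` [set w | A 0%N]).
  apply/seteqP; split=> [w|w] /=; rewrite /remaining.
    case: pselect => [h Aw|h Aw].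
      left; case: ex_minnP Aw => t /eqP Ft tmin At; exists t => //; split=> //;
        split=> //.
      case=> i /= it Fi; have := tmin i.
      by rewrite Fi eqxx leqNgt it => /(_ isT).
    right; split=> //; case=> t _ Ft; apply: h; exists t; exact/eqP.
  case=> [[t _ [[Ft nFt] At]]|[nF A0]]; case: pselect => [h|h] //=.
  - case: ex_minnP => u /eqP Fu umin.
    suff -> : u = t by [].
    apply/eqP; rewrite eqn_leq umin ?Ft ?eqxx//= leqNgt; apply/negP => ut.
    by apply: nFt; exists u.
  - by exfalso; apply: h; exists t; exact/eqP.
  - by exfalso; case: (h) => t /eqP Ft; apply: nF; exists t.
apply: measurableU.
  apply: bigcupT_measurable => t; apply: measurableI => //; apply: mS.
  by rewrite -[X in measurable X]setTI; exact: measurable_snd.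
apply: measurableI.
  by apply: measurableC; exact: bigcupT_measurable.
by case: (pselect (A 0%N)) => A0;
  [rewrite (_ : mkset _ = setT)|rewrite (_ : mkset _ = set0)] => //;
  apply/seteqP; split.
Qed.

HB.instance Definition _ S :=
  isMeasurableFun.Build _ _ _ _ (remaining S) (measurable_remaining S).

Definition scaled (X : {RV P >-> nat}) (c : R) (w : T) : R := (X w)%:R / c.

Lemma measurable_scaled X c : measurable_fun setT (scaled X c).
Proof. exact: (@measurableT_comp _ _ _ _ _ _ (fun k : nat => k%:R / c : R)). Qed.

HB.instance Definition _ X c :=
  isMeasurableFun.Build _ _ _ _ (scaled X c) (measurable_scaled X c).

Definition pgf_term (X : {RV P >-> nat}) (v : R) (k : nat) : R :=
  fine (P [set w | X w = k]) * v ^+ k.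

Definition pgf (X : {RV P >-> nat}) (v : R) : R :=
  limn (series (pgf_term X v)).

End PillsProcess.

Arguments pills_process {d T R} P m n S.
Arguments remaining {d T R} P S w.
Arguments scaled {d T R} P X c w.
Arguments pgf_term {d T R} P X v k.
Arguments pgf {d T R} P X v.

(* Convergence of the distribution functions at every continuity point of the
   limit; the Y k may live on different probability spaces. *)
Definition cvg_in_distribution (R : realType) (d : nat -> measure_display)
    (T : forall k, measurableType (d k)) (P : forall k, probability (T k) R)
    (Y : forall k, {RV (P k) >-> R}) (mu : set R -> \bar R) : Prop :=
  forall x : R, {for x, continuous (fun y : R => mu `]-oo, y]%classic)} ->
    @cdf _ _ _ (P k) (Y k) x @[k --> \oo] --> mu `]-oo, x]%classic.

Arguments cvg_in_distribution {R d T} P Y mu.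

(* Main.v *)
Require Import Defs.
From mathcomp Require Import ring lra zify.

Set Implicit Arguments.
Unset Strict Implicit.
Unset Printing Implicit Defensive.

Local Open Scope classical_set_scope.
Local Open Scope ring_scope.

(** The urn is the jump chain of a continuous-time model in which every pill
    carries an independent exponential clock of rate 1.  Let u be the time at
    which the last double-unit pill is broken and put q = e^-u.  Given q, each
    of the n original single-unit pills is still present with probability q,
    each of the other m-1 double-unit pills has been broken before u and its
    half is still present with weight u e^-u = - q ln q, and the half that has
    just appeared is present.  Hence X has the conditional generating function
    v A^n B^(m-1), where A = 1 + (v-1) q and B = 1 - q - (v-1) q ln q, and
    averaging over q gives (i).

    The proof replaces this picture by a direct check.  A trajectory with
    doubles left has only two successors of positive probability, so induction
    on 2m + n gives the law of X as the coefficients of the polynomial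
    [pills_poly], which obeys the recursion of the urn ([remaining_law]).  The
    right-hand side of (i) obeys the same recursion because A - 1 = q A' and
    B - A = q B', so that
      (n+m) A^n B^(m-1) - n A^(n-1) B^(m-1) - (m-1) A^(n+1) B^(m-2)
    is the derivative of q A^n B^(m-1) ([pills_integralS],
    [horner_pills_poly]).

    For the limit laws, (i) is read as an equality of polynomials in v, so the
    law of X is a mixture over q of the coefficients of v A^n B^(m-1)
    ([coef_pills_poly]).  These are nonnegative with total mass (1-q)^(m-1),
    and m (1-q)^(m-1) is the Beta(1,m) density, with survival function
    (1-a)^m.  Given q, X concentrates around n q + (m-1) r(q), where
    r(q) = - q ln q / (1-q) is increasing; a Chernoff bound at v = 1 - t or
    v = 1 + t, made uniform in q on either side of a threshold a by
    monotonicity, bounds P(X <= y) and P(X > y) by the Beta(1,m) mass on one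
    side of a, up to an exponentially small error ([pills_lower_tail],
    [pills_upper_tail]).  It remains to choose a so that n a + (m-1) r(a) is
    asymptotic to s times the scale: a = s/m for (ii), where
    (1 - s/m)^m -> e^-s, and a close to s for (iii).  Continuity of the limit
    distribution function closes the gap between s and x
    ([pills_cvg_in_distribution]). *)

(** * Calculus on an interval *)

Section Calculus.
Context {R : realType}.
Implicit Types (f F : R -> R) (a b q v : R).
Local Notation mu := (@lebesgue_measure R).

Lemma integrable_continuous f a b : continuous f ->
  mu.-integrable `[a, b] (EFin \o f).
Proof.
move=> cf; apply: continuous_compact_integrable; first exact: segment_compact.
exact: continuous_subspaceT.
Qed.

Lemma Rintegral_FTC f F a b : a < b -> continuous f -> continuous F ->
  (forall x, a < x < b -> is_derive x 1 F (f x)) ->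
  \int[mu]_(x in `[a, b]) f x = F b - F a.
Proof.
move=> ab cf cF dF; rewrite /Rintegral (@continuous_FTC2 _ f F)//.
- exact: continuous_subspaceT.
- split=> [x /[!in_itv]/= /dF[]//| |].
  + by apply: cvg_at_right_filter; exact: cF.
  + by apply: cvg_at_left_filter; exact: cF.
- by move=> x /[!in_itv]/= /dF dFx; rewrite derive1E derive_val.
Qed.

(** * The function q ln q and the generating functions given q *)

Lemma ln_ge_oneBV q : 0 < q -> 1 - q^-1 <= ln q.
Proof.
move=> q0; have qV0 : 0 < q^-1 by rewrite invr_gt0.
have := @le_ln1Dx R (q^-1 - 1); rewrite (addrC 1) subrK lnV ?posrE//.
by move=> /(_ ltac:(lra)); lra.
Qed.

Lemma xlnx_le0 q : q <= 1 -> q * ln q <= 0.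
Proof.
move=> q1; have [q0|q0] := leP q 0; first by rewrite ln0// mulr0.
by rewrite mulr_ge0_le0 ?ln_le0// ltW.
Qed.

Lemma xlnx_ge q : 0 <= q -> q - 1 <= q * ln q.
Proof.
rewrite le_eqVlt => /predU1P[<-|q0]; first by rewrite mul0r; lra.
have := ln_ge_oneBV q0; rewrite -(ler_pM2l q0) mulrBr mulr1 divff ?gt_eqF//.
Qed.

(** Since [ln] vanishes on nonpositive numbers, q ln q is continuous on the
    whole line; at 0 it is squeezed by 2 sqrt q, because
    q ln q = 2 q ln (sqrt q) and ln s >= 1 - 1/s.  All integrands below are thus
    globally continuous, with no special treatment of the endpoint 0. *)
Lemma continuous_xlnx : continuous (fun q : R => q * ln q).
Proof.
move=> q; have [q0|q0|->] := ltgtP q 0.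
- rewrite /continuous_at ln0 ?ltW// mulr0; apply: cvg_trans (near_eq_cvg _) (cvg_cst 0).
  near=> x; rewrite ln0 ?mulr0//; apply: ltW; near: x; exact: lt_nbhsl.
- by apply: continuousM; [exact: cvg_id|exact: continuous_ln].
rewrite /continuous_at mul0r.
have sqrt0 : Num.sqrt x @[x --> (0 : R)] --> (0 : R).
  by have := @sqrt_continuous R 0; rewrite /continuous_at sqrtr0.
have nsqrt0 : Num.sqrt `|x| @[x --> (0 : R)] --> (0 : R).
  apply: cvg_comp sqrt0; have := @norm_continuous _ R 0.
  by rewrite /continuous_at normr0.
apply: (@squeeze_cvgr _ _ _ _ (fun x => - (2 * Num.sqrt x)) (fun x => 2 * Num.sqrt `|x|)).
- near=> x.
  have x1 : x <= 1 by apply: ltW; near: x; apply: lt_nbhsl.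
  have [x0|x0] := leP x 0.
    by rewrite ler0_sqrtr// ln0// !mulr0 oppr0 lexx mulr_ge0.
  apply/andP; split; last first.
    by rewrite (le_trans (xlnx_le0 x1))// mulr_ge0.
  set s := Num.sqrt x.
  have s0 : 0 < s by rewrite sqrtr_gt0.
  have -> : x = s ^+ 2 by rewrite sqr_sqrtr// ltW.
  rewrite lnXn//; have := ln_ge_oneBV s0.
  have s20 : 0 < s ^+ 2 by rewrite exprn_gt0.
  rewrite -(ler_pM2l s20) mulrBr mulr1 expr2 mulfK ?gt_eqF//.
  rewrite mulr2n; nra.
- rewrite -[X in _ --> X]oppr0; apply: cvgN.
  by have := cvgM (cvg_cst (2 : R)) sqrt0; rewrite mulr0; apply.
- have := cvgM (cvg_cst (2 : R)) nsqrt0; rewrite mulr0; apply.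
Unshelve. all: by end_near. Qed.

(** With q = e^-u, the generating function of the indicator that a single-unit
    pill is still present at time u of the continuous-time model. *)
Definition single_gf v q := 1 + (v - 1) * q.
(** With q = e^-u, the same for the half of a double-unit pill; the pill is
    required to be broken by time u, whence a total mass 1 - q instead of 1. *)
Definition double_gf v q := 1 - q - (v - 1) * q * ln q.

Lemma continuous_single_gf v : continuous (single_gf v).
Proof.
move=> q; apply: cvgD; first exact: cvg_cst.
by apply: cvgM; [exact: cvg_cst|exact: cvg_id].
Qed.

Lemma continuous_double_gf v : continuous (double_gf v).
Proof.
move=> q; apply: cvgB.
  by apply: cvgB; [exact: cvg_cst|exact: cvg_id].
under eq_fun do rewrite -mulrA.
rewrite -mulrA; apply: cvgM; first exact: cvg_cst.
exact: continuous_xlnx.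
Qed.

Lemma continuous_expr f n : continuous f -> continuous (fun x => f x ^+ n).
Proof.
move=> cf x; apply: (@continuous_comp _ _ _ f (fun y : R => y ^+ n)).
  exact: cf.
exact: exprn_continuous.
Qed.

Definition pills_integral v n m :=
  \int[mu]_(q in `[0, 1]) (single_gf v q ^+ n * double_gf v q ^+ m).

Lemma continuous_pills_integrand v n m :
  continuous (fun q => single_gf v q ^+ n * double_gf v q ^+ m).
Proof.
move=> q; apply: cvgM; apply: continuous_expr.
  exact: continuous_single_gf.
exact: continuous_double_gf.
Qed.

Lemma is_derive_single_gf v q : is_derive q 1 (single_gf v) (v - 1).
Proof. by apply: is_derive_eq; rewrite /GRing.scale/=; ring. Qed.

Lemma is_derive_double_gf v q : 0 < q ->
  is_derive q 1 (double_gf v) (- v - (v - 1) * ln q).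
Proof.
move=> q0; have := is_derive1_ln q0 => ?.
apply: is_derive_eq; rewrite /GRing.scale/=.
by field; rewrite gt_eqF.
Qed.

(** The recursion of the urn for the integrals: integrate the derivative of
    q A^n B^m over [0, 1].  The boundary term at 1 vanishes unless m = 0, as
    B(1) = 0; this produces the initial condition v^n of the recursion. *)
Lemma pills_integralS v n m :
  (n + m.+1)%:R * pills_integral v n m =
  n%:R * pills_integral v n.-1 m + m%:R * pills_integral v n.+1 m.-1
  + v ^+ n *+ (m == 0%N).
Proof.
pose F q := q * (single_gf v q ^+ n * double_gf v q ^+ m).
pose I n m q := single_gf v q ^+ n * double_gf v q ^+ m.
pose f q := (n + m.+1)%:R * I n m q - n%:R * I n.-1 m q - m%:R * I n.+1 m.-1 q.
have cI k n' m' : continuous (fun q => (k%:R : R) * I n' m' q).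
  by move=> q; apply: cvgM; [exact: cvg_cst|exact: continuous_pills_integrand].
have cf : continuous f.
  by move=> q; apply: cvgB; [apply: cvgB|]; exact: cI.
have cF : continuous F.
  by move=> q; apply: cvgM; [exact: cvg_id|exact: continuous_pills_integrand].
have : \int[mu]_(q in `[0, 1]) f q = F 1 - F 0.
  apply: Rintegral_FTC => // q /andP[q0 q1].
  have ? := is_derive_single_gf v q; have ? := is_derive_double_gf v q0.
  have dA := is_deriveX n (is_derive_single_gf v q).
  have dB := is_deriveX m (is_derive_double_gf v q0).
  have dF := is_deriveM (is_derive_id q 1) (is_deriveM dA dB).
  have FE : id * (single_gf v ^+ n * double_gf v ^+ m) = F.
    by rewrite /F; apply/funext => x; rewrite !fctE.
  rewrite FE in dF.
  apply: is_derive_eq dF _; rewrite /GRing.scale/= /f /I !fctE.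
  have AE : single_gf v q ^+ n.+1 = single_gf v q ^+ n * (1 + (v - 1) * q).
    by rewrite exprSr.
  have An : n%:R * single_gf v q ^+ n = n%:R * single_gf v q ^+ n.-1 * (1 + (v - 1) * q).
    by case: (n) => [|k]; rewrite ?mul0r//= exprSr mulrA.
  have Bm : m%:R * double_gf v q ^+ m =
      m%:R * double_gf v q ^+ m.-1 * (1 - q - (v - 1) * q * ln q).
    by case: (m) => [|k]; rewrite ?mul0r//= exprSr mulrA.
  rewrite AE natrD -addn1 natrD.
  (* the three terms come from differentiating q, A^n and B^m *)
  transitivity (single_gf v q ^+ n * double_gf v q ^+ m
    + double_gf v q ^+ m * (n%:R * single_gf v q ^+ n - n%:R * single_gf v q ^+ n.-1)
    + single_gf v q ^+ n * (m%:R * double_gf v q ^+ m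
      - m%:R * double_gf v q ^+ m.-1 * (1 + (v - 1) * q))); last by ring.
  by rewrite An Bm; ring.
have F10 : F 1 - F 0 = v ^+ n *+ (m == 0%N).
  rewrite /F mul0r subr0 mul1r /single_gf /double_gf ln1 mulr0 !mulr1 addrC subrK subrr.
  by rewrite subr0 expr0n mulr_natr.
have iI k n' m' : mu.-integrable `[0, 1] (EFin \o (fun q => (k%:R : R) * I n' m' q)).
  exact/integrable_continuous/cI.
have iIB : mu.-integrable `[0, 1]
    (EFin \o (fun q => (n + m.+1)%:R * I n m q - n%:R * I n.-1 m q)).
  by apply: integrable_continuous => q; apply: cvgB; exact: cI.
have iI1 n' m' : mu.-integrable `[0, 1] (EFin \o I n' m').
  exact/integrable_continuous/continuous_pills_integrand.
rewrite F10 /f RintegralB// RintegralB// !RintegralZl// => <-.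
rewrite /pills_integral -/(I n m) -/(I n.-1 m) -/(I n.+1 m.-1); ring.
Qed.
End Calculus.
(** * The probability generating polynomial *)

(** The outer recursion is on the number of double-unit pills, the inner one on
    the number of single-unit pills: a step lowers the pair lexicographically.
    At n = 0 a double-unit pill is broken with probability 1. *)
Fixpoint pills_poly (R : realType) m : nat -> {poly R} :=
  if m is m'.+1 then
    fix aux n : {poly R} :=
      if n is n'.+1 then
        (n%:R / (m + n)%:R) *: aux n' + (m%:R / (m + n)%:R) *: pills_poly R m' n.+1
      else pills_poly R m' 1
  else fun n => 'X^n.

Section PillsPoly.
Context {R : realType}.
Implicit Types (v q : R) (m n : nat).

Local Notation h := (@pills_poly R).

Lemma pills_polyS m n : h m.+1 n =
  (n%:R / (m.+1 + n)%:R) *: h m.+1 n.-1 + (m.+1%:R / (m.+1 + n)%:R) *: h m n.+1.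
Proof.
case: n => [|n] //=.
by rewrite addn0 mul0r scale0r add0r divff ?pnatr_eq0// scale1r.
Qed.

(** Identity (i): both sides satisfy the same recursion.  For one double-unit
    pill the boundary term v^n of [pills_integralS] takes the role of the
    integral with a negative exponent, so both cases go through one step. *)
Lemma horner_pills_poly m n v :
  (h m.+1 n).[v] = m.+1%:R * v * pills_integral v n m.
Proof.
have step k : (forall l, (h k l.+1).[v] =
      v * (k%:R * pills_integral v l.+1 k.-1 + v ^+ l *+ (k == 0%N))) ->
    forall l, (h k.+1 l).[v] = k.+1%:R * v * pills_integral v l k.
  move=> hk l; have D0 j : (j + k.+1)%:R != 0 :> R by rewrite pnatr_eq0 addnS.
  elim: l => [|l IHl]; [apply: (mulfI (D0 0%N))|apply: (mulfI (D0 l.+1))];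
    rewrite [RHS]mulrCA pills_integralS.
    rewrite pills_polyS hornerD !hornerZ hk.
    rewrite [(k.+1 + 0)%N]addnC; have := D0 0%N.
    by move: (0 + k.+1)%:R => D D_neq0; field.
  rewrite pills_polyS hornerD !hornerZ hk IHl [(k.+1 + _)%N]addnC.
  by have := D0 l.+1; move: (l.+1 + k.+1)%:R => D D_neq0 /=; field.
elim: m n => [|m IHm]; apply: step => l.
  by rewrite /= hornerXn mul0r add0r exprS.
by rewrite IHm/= addr0 mulrCA mulrA.
Qed.

Lemma pills_poly_ge0 m n k : 0 <= (h m n)`_k.
Proof.
elim: m n => [|m IHm]; first by move=> n; rewrite /= coefXn ler0n.
elim=> [|n IHn]; rewrite pills_polyS coefD !coefZ /=.
  by rewrite addr_ge0 ?mulr_ge0// mul0r.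
by rewrite addr_ge0 ?mulr_ge0// divr_ge0.
Qed.

(** * The law as a mixture of nonnegative polynomials *)

(** The generating function given q as a polynomial in v.  Each factor is
    expanded in powers of the indeterminate, since the positivity of the
    coefficients, hidden in powers of v - 1, is what the tail bounds use. *)
Definition pills_gf q n m : {poly R} :=
  'X * ((1 - q)%:P + q *: 'X) ^+ n * ((1 - q + q * ln q)%:P + (- (q * ln q)) *: 'X) ^+ m.

Lemma horner_pills_gf q n m v :
  (pills_gf q n m).[v] = v * (single_gf v q ^+ n * double_gf v q ^+ m).
Proof.
rewrite /pills_gf !hornerM hornerX !horner_exp !hornerD !hornerZ !hornerC !hornerX.
rewrite mulrA; congr (v * _ ^+ n * _ ^+ m); rewrite /single_gf /double_gf; ring.
Qed.

Lemma continuous_sum (F : nat -> R -> R) N : (forall i, continuous (F i)) ->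
  continuous (fun x => \sum_(i < N) F i x).
Proof.
move=> cF; elim: N => [|N IHN] x; rewrite /continuous_at.
  by rewrite big_ord0; under eq_cvg do rewrite big_ord0; exact: cvg_cst.
rewrite big_ord_recr/=; under eq_cvg do rewrite big_ord_recr/=.
by apply: cvgD; [exact: IHN|exact: cF].
Qed.

Definition coefs_continuous (p : R -> {poly R}) :=
  forall k, continuous (fun q => (p q)`_k).

Lemma coefs_continuousM p r : coefs_continuous p -> coefs_continuous r ->
  coefs_continuous (fun q => p q * r q).
Proof.
move=> cp cr k; under eq_fun do rewrite coefM.
apply: (@continuous_sum (fun i q => (p q)`_i * (r q)`_(k - i))) => i q.
by apply: cvgM; [exact: cp|exact: cr].
Qed.

Lemma coefs_continuousX p n : coefs_continuous p ->
  coefs_continuous (fun q => p q ^+ n).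
Proof.
move=> cp; elim: n => [|n IHn].
  by move=> k q; under eq_fun do rewrite expr0; exact: cvg_cst.
by under eq_fun do rewrite exprS; exact: coefs_continuousM.
Qed.

Lemma coefs_continuous_affine (f g : R -> R) : continuous f -> continuous g ->
  coefs_continuous (fun q => (f q)%:P + g q *: 'X).
Proof.
move=> cf cg k q; rewrite /continuous_at coefD coefC coefZ coefX.
under eq_cvg do rewrite coefD coefC coefZ coefX.
apply: cvgD.
  by case: (k == 0%N); [exact: cf|exact: cvg_cst].
by apply: cvgM; [exact: cg|exact: cvg_cst].
Qed.

Lemma continuous_coef_pills_gf n m : coefs_continuous (fun q => pills_gf q n m).
Proof.
apply: coefs_continuousM; first apply: coefs_continuousM.
- by move=> k q; exact: cvg_cst.
- apply/coefs_continuousX/coefs_continuous_affine => q; last exact: cvg_id.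
  by apply: cvgB; [exact: cvg_cst|exact: cvg_id].
- apply: coefs_continuousX.
  apply: coefs_continuous_affine => q.
    apply: cvgD; last exact: continuous_xlnx.
    by apply: cvgB; [exact: cvg_cst|exact: cvg_id].
  apply: cvgN; exact: continuous_xlnx.
Qed.

(** The coefficients 1 - q + q ln q and - q ln q of B are nonnegative on [0, 1]
    by the bounds q - 1 <= q ln q <= 0. *)
Lemma coef_pills_gf_ge0 q n m k : 0 <= q <= 1 -> 0 <= (pills_gf q n m)`_k.
Proof.
move=> /andP[q0 q1].
have MM (p r : {poly R}) : (forall i, 0 <= p`_i) -> (forall i, 0 <= r`_i) ->
    forall i, 0 <= (p * r)`_i.
  by move=> p0 r0 i; rewrite coefM sumr_ge0// => j _; rewrite mulr_ge0.
have XX (p : {poly R}) j : (forall i, 0 <= p`_i) -> forall i, 0 <= (p ^+ j)`_i.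
  move=> p0; elim: j => [|j IHj] i; first by rewrite expr0 coef1 ler0n.
  by rewrite exprS; exact: MM.
have AA (a b : R) : 0 <= a -> 0 <= b -> forall i, 0 <= (a%:P + b *: 'X)`_i.
  move=> a0 b0 i; rewrite coefD coefC coefZ coefX addr_ge0//.
    by case: ifP.
  by rewrite mulr_ge0.
move: k; apply: (MM); first apply: (MM).
- by move=> i; rewrite coefX ler0n.
- by apply: (XX); apply: AA; rewrite ?subr_ge0.
- apply: (XX); apply: AA.
    by have := xlnx_ge q0; lra.
  by have := xlnx_le0 q1; lra.
Qed.

Lemma Rintegral_sum (F : nat -> R -> R) N (a b : R) : (forall i, continuous (F i)) ->
  \int[@lebesgue_measure R]_(x in `[a, b]) (\sum_(i < N) F i x) =
  \sum_(i < N) \int[@lebesgue_measure R]_(x in `[a, b]) F i x.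
Proof.
move=> cF; elim: N => [|N IHN].
  under eq_Rintegral do rewrite big_ord0.
  by rewrite big_ord0 Rintegral_cst// mul0r.
rewrite big_ord_recr/= -IHN -RintegralD//; do ?exact: integrable_continuous; last first.
  exact/integrable_continuous/continuous_sum.
by apply: eq_Rintegral => x _; rewrite big_ord_recr.
Qed.

Lemma poly_ext_horner (p r : {poly R}) : (forall v, p.[v] = r.[v]) -> p = r.
Proof.
move=> pr; apply/eqP; rewrite -subr_eq0; apply/eqP.
apply: (@roots_geq_poly_eq0 _ _ [seq i%:R | i <- iota 0 (size (p - r))]).
- by apply/allP => x _; rewrite /root hornerD hornerN pr subrr.
- rewrite map_inj_uniq ?iota_uniq// => i j /eqP; rewrite eqr_nat; exact: eqP.
- by rewrite size_map size_iota.
Qed.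

(** Since (i) holds for every v, it can be compared coefficient by coefficient;
    the uniform bound on the degree lets the integral pass through the sum. *)
Lemma coef_pills_poly m n k :
  (h m.+1 n)`_k = m.+1%:R *
    \int[@lebesgue_measure R]_(q in `[0, 1]) (pills_gf q n m)`_k.
Proof.
have size_gf q : (size (pills_gf q n m) <= n + m + 2)%N.
  have SA (a b : R) j : (size ((a%:P + b *: 'X) ^+ j) <= j.+1)%N.
    have: (size (a%:P + b *: 'X)%R <= 2)%N.
      apply/leq_sizeP => i i2; rewrite coefD coefC coefZ coefX.
      by case: i i2 => [|[|]]//= *; rewrite mulr0 addr0.
    move=> s2; apply: leq_trans (size_poly_exp_leq _ _) _.
    by rewrite ltnS -[leqRHS]mul1n leq_mul//; lia.
  rewrite /pills_gf; set A := _ ^+ n; set B := _ ^+ m.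
  have := size_polyMleq ('X * A) B; have := size_polyMleq 'X A.
  have : (size A <= n.+1)%N by exact: SA.
  have : (size B <= m.+1)%N by exact: SA.
  rewrite size_polyX; move: (size A) (size B) (size ('X * A)%R) (size ('X * A * B)%R).
  by move=> a b c d; lia.
pose p := \poly_(i < n + m + 2) (m.+1%:R *
  \int[@lebesgue_measure R]_(q in `[0, 1]) (pills_gf q n m)`_i).
suff -> : h m.+1 n = p.
  rewrite coef_poly; case: ltnP => // km.
  under eq_Rintegral do rewrite (leq_sizeP _ _ (size_gf _)) //.
  by rewrite Rintegral_cst// mul0r mulr0.
apply: poly_ext_horner => v; rewrite horner_pills_poly.
rewrite horner_poly /p /pills_integral -mulrA -RintegralZl//; last first.
  exact/integrable_continuous/continuous_pills_integrand.
pose F i q := (pills_gf q n m)`_i * v ^+ i.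
have -> : \int[@lebesgue_measure R]_(q in `[0, 1])
      (v * (single_gf v q ^+ n * double_gf v q ^+ m)) =
    \int[@lebesgue_measure R]_(q in `[0, 1]) (\sum_(i < n + m + 2) F i q).
  apply: eq_Rintegral => q _.
  by rewrite -horner_pills_gf (horner_coef_wide _ (size_gf q)).
rewrite Rintegral_sum => [|i q]; last first.
  by apply: cvgM; [exact: continuous_coef_pills_gf|exact: cvg_cst].
rewrite mulr_sumr; apply: eq_bigr => i _; rewrite RintegralZr// ?mulrA//.
exact/integrable_continuous/continuous_coef_pills_gf.
Qed.
End PillsPoly.
(** * The law of the remaining pills *)

Section PillsChain.
Context d (T : measurableType d) (R : realType) (P : probability T R).

(** Splitting along two events that carry all the mass of [A], so that the
    other, infinitely many, possible successor states need not be summed over. *)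
Lemma probability_split (A B E F : set T) :
  measurable A -> measurable B -> measurable E -> measurable F ->
  E `&` F = set0 -> (P (A `&` E) + P (A `&` F) = P A)%E ->
  (P (A `&` B) = P (A `&` E `&` B) + P (A `&` F `&` B))%E.
Proof.
move=> mA mB mE mF EF PA.
have mEF : measurable (E `|` F) by exact: measurableU.
have split C : measurable C -> P (C `&` (E `|` F)) = (P (C `&` E) + P (C `&` F))%E.
  move=> mC; rewrite setIUr measureU//; do ?exact: measurableI.
  by rewrite setIACA setIid EF setI0.
have null : P (A `\` (E `|` F)) = 0%E.
  have : (P A = P (A `\` (E `|` F)) + P (A `&` (E `|` F)))%E by exact: measureDI.
  rewrite (split _ mA) PA.
  have : P A \is a fin_num by exact: fin_num_measure.
  have : P (A `\` (E `|` F)) \is a fin_num.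
    by apply: fin_num_measure; exact: measurableD.
  move=> /fineK <- /fineK <-; rewrite -EFinD => -[?].
  by congr EFin; lra.
have -> : (P (A `&` B) = P (A `&` B `\` (E `|` F)) + P (A `&` B `&` (E `|` F)))%E.
  by apply: measureDI => //; exact: measurableI.
rewrite split; last exact: measurableI.
rewrite [X in (X + _)%E](_ : _ = 0%E) ?add0e; last first.
  apply/eqP; rewrite eq_le measure_ge0 andbT -null le_measure ?inE//.
  - by apply: measurableD => //; exact: measurableI.
  - exact: measurableD.
  - by move=> w [[Aw _] nEF].
by congr (P _ + P _)%E; rewrite setIAC.
Qed.

Variable S : nat -> {RV P >-> (nat * nat)%type}.

Definition trajectory t (s : nat -> nat * nat) : set T :=
  [set w | forall i, (i <= t)%N -> S i w = s i].

Lemma measurable_state t x : measurable [set w | S t w = x].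
Proof.
have -> : [set w | S t w = x] = setT `&` S t @^-1` ([set x.1] `*` [set x.2]).
  rewrite setTI; apply/seteqP; split => w /= => [->//|[]].
  by case: (S t w) x => [a b] [c e] /= -> ->.
by apply: measurable_funPT => //; exact: measurableX.
Qed.

Lemma measurable_trajectory t s : measurable (trajectory t s).
Proof.
have -> : trajectory t s = \bigcap_(i in [set i | (i <= t)%N]) [set w | S i w = s i].
  by apply/seteqP; split => w ws i; exact: ws.
by apply: bigcap_measurable => [|i _]; [exists 0%N|exact: measurable_state].
Qed.

Lemma measurable_remaining_set (A : set nat) : measurable [set w | A (remaining P S w)].
Proof.
by have := @measurable_remaining _ _ _ P S measurableT A; rewrite setTI; exact.
Qed.

Lemma remaining_trajectory t s w : trajectory t s w ->
  (forall i, (i < t)%N -> (s i).1 != 0%N) -> (s t).1 = 0%N ->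
  remaining P S w = (s t).2.
Proof.
move=> ws s0 st; rewrite /remaining; case: pselect => [h|[]]; last first.
  by exists t; rewrite ws// st.
case: ex_minnP => u Su umin; have ut : (u <= t)%N by apply: umin; rewrite ws// st.
move: ut Su; rewrite leq_eqVlt => /predU1P[->|ut]; first by rewrite ws.
by rewrite ws ?(ltnW ut)// (negbTE (s0 _ ut)).
Qed.

Variables (m0 n0 : nat).
Hypothesis SP : pills_process P m0 n0 S.

(** Markov property at a trajectory that has not been stopped before time [t].
    The induction is on 2m + n, which drops by one in every possible step; the
    step that eats a single-unit pill at n = 0 does not lower it but has
    probability 0, hence the disjunction in [step]. *)
Lemma remaining_trajectory_law k N t s : ((s t).1.*2 + (s t).2 < N)%N ->
  (forall i, (i < t)%N -> (s i).1 != 0%N) ->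
  P (trajectory t s `&` [set w | remaining P S w = k]) =
  (P (trajectory t s) * ((pills_poly R (s t).1 (s t).2)`_k)%:E)%E.
Proof.
have mrem := measurable_remaining_set [set k].
elim: N t s => // N IHN t s; rewrite ltnS => stN s0.
have mtr := measurable_trajectory t s.
case st : (s t) stN => [[|m] n]; rewrite [_.1]/= [_.2]/= => stN.
  have rem w : trajectory t s w -> remaining P S w = n.
    by move=> ws; rewrite (remaining_trajectory ws s0) st.
  rewrite [pills_poly _ _ _]/= coefXn; have [->|kn] := eqVneq k n.
    by rewrite mule1; congr (P _); apply: setIidl => w /rem.
  rewrite mule0 [X in P X](_ : _ = set0) ?measure0//.
  by apply/seteqP; split => w //= [/rem -> nk]; rewrite nk eqxx in kn.
pose ext x i := if (i <= t)%N then s i else x.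
have trE x : trajectory t.+1 (ext x) = trajectory t s `&` [set w | S t.+1 w = x].
  rewrite /trajectory /ext; apply/seteqP; split => w /=.
    move=> ws; split; last by rewrite ws// ltnn.
    by move=> i it; rewrite ws ?it// leqW.
  move=> [ws St] i; rewrite leq_eqVlt ltnS => /predU1P[->|it]; first by rewrite ltnn.
  by rewrite it ws.
have Ptr x : P (trajectory t s `&` [set w | S t.+1 w = x]) =
    (P (trajectory t s) * (pill_step R (m.+1, n) x)%:E)%E.
  rewrite -trE /trajectory SP.2 {2 3}/ext leqnn ltnn st; congr (P _ * _)%E.
  by apply/seteqP; split => w ws i it; have := ws i it; rewrite /ext it.
have step x : (x.1.*2 + x.2 < N)%N \/ pill_step R (m.+1, n) x = 0 ->
    P (trajectory t s `&` [set w | S t.+1 w = x] `&` [set w | remaining P S w = k]) =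
    (P (trajectory t s) * (pill_step R (m.+1, n) x * (pills_poly R x.1 x.2)`_k)%:E)%E.
  move=> [xN|x0].
    rewrite -trE IHN; last 2 first.
    - by rewrite /ext ltnn.
    - move=> i; rewrite ltnS leq_eqVlt /ext => /predU1P[->|it].
        by rewrite leqnn st.
      by rewrite ltnW// s0.
    by rewrite trE Ptr /ext ltnn EFinM muleA.
  rewrite x0 mul0r mule0; apply/eqP; rewrite eq_le measure_ge0 andbT.
  rewrite -[leRHS](_ : P (trajectory t s `&` [set w | S t.+1 w = x]) = 0%E); last first.
    by rewrite Ptr x0 mule0.
  rewrite le_measure ?inE//; first apply: measurableI => //.
  - by apply: measurableI => //; exact: measurable_state.
  - by apply: measurableI => //; exact: measurable_state.
have w1 : pill_step R (m.+1, n) (m.+1, n.-1) = n%:R / (m.+1 + n)%:R.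
  rewrite /= eqxx mulr1 xpair_eqE; have /negbTE -> : m.+1 != m by lia.
  by rewrite mulr0 addr0.
have w2 : pill_step R (m.+1, n) (m, n.+1) = m.+1%:R / (m.+1 + n)%:R.
  rewrite /= eqxx mulr1 xpair_eqE; have /negbTE -> : m != m.+1 by lia.
  by rewrite mulr0 add0r.
have PAfin : P (trajectory t s) \is a fin_num by exact: fin_num_measure.
rewrite (@probability_split _ _ [set w | S t.+1 w = (m.+1, n.-1)]
   [set w | S t.+1 w = (m, n.+1)])//; try exact: measurable_state.
- rewrite !step ?w1 ?w2/=; last 2 first.
  + by left; lia.
  + by case: (n) stN => [|n'] stN; [right; rewrite mul0r|left; lia].
  rewrite -(fineK PAfin) -!EFinM -EFinD -mulrDr.
  congr ((_ * _)%:E); rewrite -[RHS]/((pills_poly R m.+1 n)`_k).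
  by rewrite pills_polyS coefD !coefZ.
- by apply/seteqP; split => w //= [-> []] /eqP; lia.
- rewrite !Ptr w1 w2 -(fineK PAfin) -!EFinM -EFinD -mulrDr -mulrDl -natrD addnC.
  by rewrite divff ?mulr1// pnatr_eq0.
Qed.

Lemma remaining_law k :
  P [set w | remaining P S w = k] = ((pills_poly R m0 n0)`_k)%:E.
Proof.
have := @remaining_trajectory_law k (m0.*2 + n0).+1 0 (fun=> (m0, n0)).
have -> : trajectory 0 (fun=> (m0, n0)) = [set w | S 0%N w = (m0, n0)].
  by apply/seteqP; split => w /= ws; [exact: ws|case].
rewrite SP.1 mul1e => <-; [|exact: ltnSn|by []].
have mrem := measurable_remaining_set [set k].
have mS := measurable_state 0 (m0, n0).
rewrite [LHS](@measureDI _ _ _ P _ [set w | S 0%N w = (m0, n0)])//.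
rewrite [X in (X + _)%E](_ : _ = 0%E) ?add0e 1?setIC//.
apply/eqP; rewrite eq_le measure_ge0 andbT.
apply: (@le_trans _ _ (P (~` [set w | S 0%N w = (m0, n0)]))).
  apply: le_measure; rewrite ?inE; [exact: measurableD|exact: measurableC|by move=> w []].
by rewrite probability_setC// SP.1 subee.
Qed.

End PillsChain.
(** * Tail bounds *)

Section TailBounds.
Context {R : realType}.
Implicit Types (a q v t : R) (m n K : nat).
Local Notation mu := (@lebesgue_measure R).
Local Notation h := (@pills_poly R).

Lemma Rintegral_split (f : R -> R) a b c : a <= b <= c -> continuous f ->
  \int[mu]_(x in `[a, c]) f x =
  \int[mu]_(x in `[a, b]) f x + \int[mu]_(x in `[b, c]) f x.
Proof.
move=> /andP[ab bc] cf; have ic := @integrable_continuous R f a c cf.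
rewrite -(Rintegral_itv_obnd_cbnd (r := b)); last first.
  apply: integrableS (integrable_continuous b c cf) => //.
  by apply: subset_itvr; rewrite bnd_simp.
have := Rintegral_itvB ic (x := b).
by rewrite !bnd_simp => <- //; rewrite addrC subrK.
Qed.

Lemma continuous_onemX m : continuous (fun q : R => (1 - q) ^+ m).
Proof.
by apply: continuous_expr => q; apply: cvgB; [exact: cvg_cst|exact: cvg_id].
Qed.

Lemma Rintegral_onemX m a b : a < b ->
  m.+1%:R * \int[mu]_(q in `[a, b]) (1 - q) ^+ m =
  (1 - a) ^+ m.+1 - (1 - b) ^+ m.+1.
Proof.
move=> ab; have cq := @continuous_onemX m; have cq1 := @continuous_onemX m.+1.
rewrite -RintegralZl//; last exact: integrable_continuous.
have dF q : a < q < b ->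
    is_derive q 1 (fun q : R => - (1 - q) ^+ m.+1) (m.+1%:R * (1 - q) ^+ m).
  move=> _; have d1 : is_derive q 1 (fun x : R => 1 - x) (- 1 : R).
    by apply: is_derive_eq; rewrite /GRing.scale/=; ring.
  have := is_deriveN (is_deriveX m.+1 d1); rewrite exprfctE.
  by move=> dd; apply: is_derive_eq dd _; rewrite /GRing.scale/=; ring.
rewrite (Rintegral_FTC ab _ _ dF); first by rewrite opprK addrC.
- by move=> q; apply: cvgM; [exact: cvg_cst|exact: cq].
- by move=> q; apply: cvgN; exact: cq1.
Qed.

(** Comparison with the Beta(1, m+1) density (m+1) (1-q)^m, whose mass is
    1 - (1-a)^(m+1) below a and (1-a)^(m+1) above. *)
Lemma onemX_integral_le (J : R -> R) m a (A B : R) : 0 < a < 1 -> continuous J ->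
  (forall q, 0 <= q <= a -> J q <= A * (1 - q) ^+ m) ->
  (forall q, a <= q <= 1 -> J q <= B * (1 - q) ^+ m) ->
  m.+1%:R * \int[mu]_(q in `[0, 1]) J q <=
    A * (1 - (1 - a) ^+ m.+1) + B * (1 - a) ^+ m.+1.
Proof.
move=> /andP[a0 a1] cJ JA JB.
rewrite (@Rintegral_split _ _ a)//; last by rewrite !ltW.
have cq := @continuous_onemX m.
have bound u w (C : R) : u < w -> (forall q, u <= q <= w -> J q <= C * (1 - q) ^+ m) ->
    m.+1%:R * \int[mu]_(q in `[u, w]) J q <= C * ((1 - u) ^+ m.+1 - (1 - w) ^+ m.+1).
  move=> uw JC; rewrite -Rintegral_onemX// mulrCA ler_pM2l ?ltr0n//.
  rewrite -RintegralZl//; last exact: integrable_continuous.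
  apply: le_Rintegral => //; do ?exact: integrable_continuous.
  by apply: integrable_continuous => q; apply: cvgM; [exact: cvg_cst|exact: cq].
rewrite mulrDr; have := bound _ _ _ a0 JA; have := bound _ _ _ a1 JB.
by rewrite subrr expr0n/= !subr0 expr1n; lra.
Qed.

Definition head_sum (p : {poly R}) K := \sum_(k < K.+1) p`_k.

Section HeadSum.
Variable p : {poly R}.
Hypothesis p_ge0 : forall k, 0 <= p`_k.

Lemma head_sum_ge0 K : 0 <= head_sum p K.
Proof. exact: sumr_ge0. Qed.

Lemma horner_head_tail v K : p.[v] =
  \sum_(k < K.+1) p`_k * v ^+ k + \sum_(K.+1 <= k < K.+1 + size p) p`_k * v ^+ k.
Proof.
rewrite (@horner_coef_wide _ (K.+1 + size p)) ?leq_addl//.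
rewrite -!(big_mkord xpredT (fun k => p`_k * v ^+ k)).
by rewrite (@big_cat_nat _ _ _ K.+1)//= leq_addr.
Qed.

Lemma head_sum_le K : head_sum p K <= p.[1].
Proof.
rewrite (horner_head_tail 1 K) -[leLHS]addr0 lerD//.
  by apply: ler_sum => k _; rewrite expr1n mulr1.
by apply: sumr_ge0 => k _; rewrite expr1n mulr1.
Qed.

Lemma head_sum_chernoff v K : 0 <= v <= 1 -> head_sum p K * v ^+ K <= p.[v].
Proof.
move=> /andP[v0 v1]; rewrite (horner_head_tail v K).
rewrite -[leLHS]addr0 lerD//; last first.
  by apply: sumr_ge0 => k _; rewrite mulr_ge0// exprn_ge0.
rewrite mulr_suml; apply: ler_sum => -[k kK] _ /=; apply: ler_wpM2l => //.
by apply: ler_wiXn2l.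
Qed.

Lemma tail_sum_chernoff v K : 1 <= v -> (p.[1] - head_sum p K) * v ^+ K.+1 <= p.[v].
Proof.
move=> v1; have v0 : 0 <= v by rewrite (le_trans _ v1).
have -> : p.[1] - head_sum p K = \sum_(K.+1 <= k < K.+1 + size p) p`_k.
  rewrite (horner_head_tail 1 K) /head_sum.
  under eq_bigr do rewrite expr1n mulr1.
  by rewrite addrC addKr; under eq_bigr do rewrite expr1n mulr1.
rewrite (horner_head_tail v K) -[leLHS]add0r lerD//.
  by apply: sumr_ge0 => k _; rewrite mulr_ge0// exprn_ge0.
rewrite mulr_suml !big_nat; apply: ler_sum => k /andP[Kk _]; apply: ler_wpM2l => //.
by apply: ler_weXn2l.
Qed.

End HeadSum.

Lemma head_sum_pills_poly m n K :
  head_sum (h m.+1 n) K =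
  m.+1%:R * \int[mu]_(q in `[0, 1]) (head_sum (pills_gf q n m) K).
Proof.
rewrite /head_sum (Rintegral_sum (F := fun k q => (pills_gf q n m)`_k)).
  by rewrite mulr_sumr; apply: eq_bigr => k _; rewrite coef_pills_poly.
by move=> i; exact: continuous_coef_pills_gf.
Qed.

Lemma continuous_head_sum m n K : continuous (fun q => head_sum (pills_gf q n m) K).
Proof.
apply: (continuous_sum (F := fun k q => (pills_gf q n m)`_k)) => i.
exact: continuous_coef_pills_gf.
Qed.

Lemma horner1_pills_gf q n m : (pills_gf q n m).[1] = (1 - q) ^+ m.
Proof.
by rewrite horner_pills_gf /single_gf /double_gf subrr !mul0r addr0 expr1n subr0 !mul1r.
Qed.

Lemma horner1_pills_poly m n : (h m.+1 n).[1] = 1.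
Proof.
rewrite horner_pills_poly mulr1 /pills_integral.
have -> : \int[mu]_(q in `[0, 1]) (single_gf 1 q ^+ n * double_gf 1 q ^+ m) =
    \int[mu]_(q in `[0, 1]) (1 - q) ^+ m.
  by apply: eq_Rintegral => q _; rewrite -(horner1_pills_gf q n) horner_pills_gf mul1r.
by rewrite Rintegral_onemX// subr0 subrr expr0n subr0 expr1n.
Qed.

(** Convexity of q ln q, which vanishes at 1: its chord to 1 has increasing
    slope.  The proof adds the tangent-line bounds ln u <= u - 1 at u = q'/q
    and at u = q', with suitable weights. *)
Lemma xlnx_slope q q' : 0 <= q <= q' -> q' <= 1 ->
  q' * ln q' * (1 - q) <= q * ln q * (1 - q').
Proof.
move=> /andP[]; rewrite le_eqVlt => /predU1P[<- q'0 q'1|q0 qq' q'1].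
  by rewrite subr0 !mul0r mulr1 xlnx_le0.
have q'0 : 0 < q' by exact: lt_le_trans qq'.
have H1 : q * ln q' - q * ln q <= q' - q.
  have := @ln_ge_oneBV R (q / q'); rewrite divr_gt0// => /(_ isT).
  rewrite ln_div ?posrE// invf_div -(ler_pM2l q0) mulrBr mulr1 mulrCA divff ?gt_eqF//.
  by rewrite mulr1; lra.
have H2 : ln q' <= q' - 1.
  by have := @le_ln1Dx R (q' - 1); rewrite (addrC 1) subrK; apply; lra.
have H3 : 0 <= (1 - q') * (q' - q - q * ln q' + q * ln q) by rewrite mulr_ge0; lra.
have H4 : 0 <= (q' - q) * (q' - 1 - ln q') by rewrite mulr_ge0; lra.
rewrite -subr_ge0; have -> : q * ln q * (1 - q') - q' * ln q' * (1 - q) =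
  (1 - q') * (q' - q - q * ln q' + q * ln q) + (q' - q) * (q' - 1 - ln q') by ring.
exact: addr_ge0.
Qed.

(** The probability that the half of a double-unit pill is still present at
    time u, given that the pill has been broken by then, where a = e^-u. *)
Definition half_survival a := - (a * ln a) / (1 - a).

Lemma half_survival_itv a : 0 < a < 1 -> 0 <= half_survival a <= 1.
Proof.
move=> /andP[a0 a1]; have a1' : 0 < 1 - a by lra.
have := xlnx_ge (ltW a0); have := xlnx_le0 (ltW a1) => *.
by rewrite /half_survival divr_ge0 ?ler_pdivrMr/= ?mul1r//; lra.
Qed.

Lemma half_survival_lower a q : 0 < a < 1 -> a <= q <= 1 ->
  half_survival a * (1 - q) <= - (q * ln q).
Proof.
move=> /andP[a0 a1] /andP[aq q1]; rewrite /half_survival mulrAC ler_pdivrMr ?subr_gt0//.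
by rewrite !mulNr lerN2 xlnx_slope// ltW.
Qed.

Lemma half_survival_upper a q : 0 < a < 1 -> 0 <= q <= a ->
  - (q * ln q) <= half_survival a * (1 - q).
Proof.
move=> /andP[a0 a1] /andP[q0 qa]; rewrite /half_survival mulrAC ler_pdivlMr ?subr_gt0//.
by rewrite !mulNr lerN2 xlnx_slope// ?q0// ltW.
Qed.

(** Below a, the Beta mass bounds the mixture.  For q >= a, the Chernoff bound
    at v = 1 - t is used: A decreases in q, and B / (1-q) = 1 - t r(q) decreases
    because r is increasing, so both are at most their values at a. *)
Lemma pills_lower_tail m n K a t : 0 < a < 1 -> 0 <= t < 1 ->
  head_sum (h m.+1 n) K <= 1 - (1 - a) ^+ m.+1 +
    (1 - t * a) ^+ n * (1 - t * half_survival a) ^+ m / (1 - t) ^+ K.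
Proof.
move=> a01 /andP[t0 t1]; have /andP[a0 a1] := a01.
have /andP[r0 r1] := half_survival_itv a01.
have vK : 0 < (1 - t) ^+ K by rewrite exprn_gt0; lra.
set C := _ / _; have C0 : 0 <= C.
  rewrite divr_ge0 ?(ltW vK)// mulr_ge0// exprn_ge0//; nra.
rewrite head_sum_pills_poly.
apply: le_trans (onemX_integral_le (A := 1) (B := C) a01 _ _ _) _.
- exact: continuous_head_sum.
- move=> q /andP[q0 qa]; rewrite mul1r -(horner1_pills_gf q n) head_sum_le// => k.
  by rewrite coef_pills_gf_ge0//; lra.
- move=> q /andP[aq q1]; have q0 : 0 <= q by lra.
  rewrite /C mulrAC ler_pdivlMr//.
  apply: (le_trans (head_sum_chernoff _ _ _)).
    by move=> k; rewrite coef_pills_gf_ge0//; lra.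
    by lra.
  rewrite horner_pills_gf.
  have H1 := half_survival_lower a01 (introT andP (conj aq q1)).
  have H2 := xlnx_ge q0.
  have H3 := xlnx_le0 q1.
  have A0 : 0 <= single_gf (1 - t) q by rewrite /single_gf; nra.
  have A1 : single_gf (1 - t) q <= 1 - t * a by rewrite /single_gf; nra.
  have B0 : 0 <= double_gf (1 - t) q.
    rewrite /double_gf -mulrA; nra.
  have B1 : double_gf (1 - t) q <= (1 - t * half_survival a) * (1 - q).
    rewrite /double_gf -mulrA; nra.
  rewrite -mulrA -exprMn -[leRHS]mul1r ler_pM ?mulr_ge0 ?exprn_ge0//; [lra|lra|].
  by rewrite ler_pM ?exprn_ge0// lerXn2r// nnegrE// (le_trans _ A1, le_trans _ B1).
- rewrite mul1r lerD2l ler_piMr// exprn_ile1//; lra.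
Qed.

(** The mirror image: above a, the Beta mass is used; for q <= a, the Chernoff
    bound at v = 1 + t, where A and B / (1-q) = 1 + t r(q) are increasing in q.
    The factor v of the generating function turns the exponent K+1 into K. *)
Lemma pills_upper_tail m n K a t : 0 < a < 1 -> 0 <= t ->
  1 - head_sum (h m.+1 n) K <= (1 - a) ^+ m.+1 +
    (1 + t * a) ^+ n * (1 + t * half_survival a) ^+ m / (1 + t) ^+ K.
Proof.
move=> a01 t0; have /andP[a0 a1] := a01.
have /andP[r0 r1] := half_survival_itv a01.
have t1 : 0 < 1 + t by lra.
have vK : 0 < (1 + t) ^+ K by rewrite exprn_gt0.
set C := _ / _; have C0 : 0 <= C.
  rewrite divr_ge0 ?(ltW vK)// mulr_ge0// exprn_ge0//; nra.
have -> : 1 - head_sum (h m.+1 n) K =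
   m.+1%:R * \int[mu]_(q in `[0, 1]) ((1 - q) ^+ m - head_sum (pills_gf q n m) K).
  rewrite RintegralB//; last first.
    exact/integrable_continuous/continuous_head_sum.
    exact/integrable_continuous/continuous_onemX.
  rewrite mulrBr -head_sum_pills_poly Rintegral_onemX//.
  by rewrite subr0 subrr expr0n subr0 expr1n.
apply: le_trans (onemX_integral_le (A := C) (B := 1) a01 _ _ _) _.
- by move=> q; apply: cvgB; [exact: continuous_onemX|exact: continuous_head_sum].
- move=> q /andP[q0 qa]; have q1 : q <= 1 by lra.
  rewrite /C mulrAC ler_pdivlMr// -(ler_pM2r t1) -mulrA -exprSr.
  have p0 k : 0 <= (pills_gf q n m)`_k by rewrite coef_pills_gf_ge0//; lra.
  have := tail_sum_chernoff p0 K (v := 1 + t); rewrite lerDl => /(_ t0).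
  rewrite horner1_pills_gf horner_pills_gf => /le_trans; apply.
  rewrite [leRHS]mulrC.
  have H1 := half_survival_upper a01 (introT andP (conj q0 qa)).
  have H3 := xlnx_le0 q1.
  have A0 : 0 <= single_gf (1 + t) q by rewrite /single_gf; nra.
  have A1 : single_gf (1 + t) q <= 1 + t * a by rewrite /single_gf; nra.
  have B0 : 0 <= double_gf (1 + t) q.
    rewrite /double_gf -mulrA; nra.
  have B1 : double_gf (1 + t) q <= (1 + t * half_survival a) * (1 - q).
    rewrite /double_gf -mulrA; nra.
  rewrite ler_pM2l// -mulrA -exprMn.
  by rewrite ler_pM ?exprn_ge0// lerXn2r// nnegrE// (le_trans _ A1, le_trans _ B1).
- move=> q /andP[aq q1]; rewrite mul1r gerBl head_sum_ge0// => k.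
  by rewrite coef_pills_gf_ge0//; lra.
- rewrite mul1r addrC lerD2l ler_piMr//.
  have : 0 <= (1 - a) ^+ m.+1 by rewrite exprn_ge0; lra.
  lra.
Qed.

End TailBounds.
(** * Limits of the tail bounds *)

Section Limits.
Context {R : realType}.
Implicit Types (a q v t x y : R) (K : nat).
Local Notation h := (@pills_poly R).

Lemma ler_expr_exp (b x : R) n : 0 <= b -> b <= expR x -> b ^+ n <= expR (n%:R * x).
Proof.
by move=> b0 bx; rewrite expRM_natl lerXn2r// nnegrE// expR_ge0.
Qed.

(** One less than the conditional mean of X given q = a; the pill broken last,
    left out here, is negligible at every scale that tends to infinity. *)
Definition pills_mean m n a : R := n%:R * a + m.-1%:R * half_survival a.

(** All factors are compared with exponentials by 1 + x <= e^x, the last one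
    because 1/(1-t) = 1 + t/(1-t). *)
Lemma lower_tail_exp m n K a t y : 0 < a < 1 -> 0 <= t < 1 -> K%:R <= y ->
  (1 - t * a) ^+ n * (1 - t * half_survival a) ^+ m.-1 / (1 - t) ^+ K <=
  expR (- (t * (pills_mean m n a - y / (1 - t)))).
Proof.
move=> a01 /andP[t0 t1] Ky; have /andP[r0 r1] := half_survival_itv a01.
have /andP[a0 a1] := a01.
have t1' : 0 < 1 - t by lra.
have -> : - (t * (pills_mean m n a - y / (1 - t))) =
  n%:R * - (t * a) + m.-1%:R * - (t * half_survival a) + t / (1 - t) * y.
  by rewrite /pills_mean; field; rewrite gt_eqF.
have e0 x : 0 <= expR x :> R by exact: expR_ge0.
have e1 x : 1 - x <= expR (- x) by exact: expR_ge1Dx.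
rewrite !expRD; apply: ler_pM.
- by rewrite mulr_ge0// exprn_ge0//; nra.
- by rewrite invr_ge0 exprn_ge0// ltW.
- by apply: ler_pM; rewrite ?exprn_ge0 ?ler_expr_exp//; nra.
apply: (@le_trans _ _ (expR (K%:R * (t / (1 - t))))).
  rewrite -exprVn ler_expr_exp ?invr_ge0 ?(ltW t1')//.
  apply: le_trans (expR_ge1Dx _); rewrite le_eqVlt; apply/orP; left; apply/eqP.
  by field; rewrite gt_eqF.
by rewrite ler_expR mulrC ler_wpM2l// divr_ge0// ltW.
Qed.

Lemma upper_tail_exp m n K a t y : 0 < a < 1 -> 0 <= t -> y <= K%:R + 1 ->
  (1 + t * a) ^+ n * (1 + t * half_survival a) ^+ m.-1 / (1 + t) ^+ K <=
  expR (- (t * ((y - 1) / (1 + t) - pills_mean m n a))).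
Proof.
move=> a01 t0 Ky; have /andP[r0 r1] := half_survival_itv a01.
have /andP[a0 a1] := a01.
have t1' : 0 < 1 + t by lra.
have -> : - (t * ((y - 1) / (1 + t) - pills_mean m n a)) =
  n%:R * (t * a) + m.-1%:R * (t * half_survival a) - t / (1 + t) * (y - 1).
  by rewrite /pills_mean; field; rewrite gt_eqF.
have e0 x : 0 <= expR x :> R by exact: expR_ge0.
rewrite !expRD; apply: ler_pM.
- by rewrite mulr_ge0// exprn_ge0//; nra.
- by rewrite invr_ge0 exprn_ge0// ltW.
- by apply: ler_pM; rewrite ?exprn_ge0 ?ler_expr_exp// ?expR_ge1Dx//; nra.
apply: (@le_trans _ _ (expR (K%:R * - (t / (1 + t))))).
  rewrite -exprVn ler_expr_exp ?invr_ge0 ?(ltW t1')//.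
  apply: le_trans (expR_ge1Dx _); rewrite le_eqVlt; apply/orP; left; apply/eqP.
  by field; rewrite gt_eqF.
rewrite ler_expR mulrN lerN2 [leRHS]mulrC; apply: ler_wpM2l; last lra.
by rewrite divr_ge0// ltW.
Qed.

Lemma cvg_expRN_cst (c : nat -> R) (e : R) : 0 < e -> c @ \oo --> +oo ->
  expR (- (e * c k)) @[k --> \oo] --> (0 : R).
Proof.
move=> e0 cy; apply: (@cvg_comp _ _ _ (fun k => e * c k) (fun x : R => expR (- x)) _
  (pinfty_nbhs R)).
  apply/cvgryPge => A; near=> k; rewrite mulrC -ler_pdivrMr//.
  by near: k; exact: cvgry_ge.
exact: cvgr_expR.
Unshelve. all: by end_near. Qed.

Section TailLimits.
Variables (m n : nat -> nat) (c a : nat -> R) (s L : R).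
Hypotheses (c_oo : c @ \oo --> +oo) (m_gt0 : \forall k \near \oo, (0 < m k)%N).
Hypotheses (a01 : \forall k \near \oo, 0 < a k < 1).
Hypotheses (a_cvg : (1 - a k) ^+ m k @[k --> \oo] --> L).
Hypotheses (mean_cvg : pills_mean (m k) (n k) (a k) / c k @[k --> \oo] --> s).

Let F k x := head_sum (h (m k) (n k)) (Num.truncn (c k * x)).

(** The exponent of the Chernoff bound is - t c_k (s - x/(1-t) + o(1)), and t
    can be chosen with x/(1-t) < s since x < s. *)
Lemma lower_tail_cvg x : 0 <= x < s -> exists2 U : nat -> R,
  U @ \oo --> 1 - L & \forall k \near \oo, F k x <= U k.
Proof.
move=> /andP[x0 xs].
(* then x / (1 - t) is the harmonic mean of x and s *)
pose t := (s - x) / (2 * s); have s0 : 0 < s by lra.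
have t0 : 0 < t by rewrite divr_gt0//; lra.
have t1 : t < 1 by rewrite ltr_pdivrMr; lra.
pose z := x / (1 - t).
have zs : z < s.
  rewrite /z ltr_pdivrMr; last lra.
  have -> : s * (1 - t) = (s + x) / 2 by rewrite /t; field; rewrite gt_eqF.
  lra.
pose e := t * ((s - z) / 2); have e0 : 0 < e by rewrite mulr_gt0//; lra.
exists (fun k => 1 - (1 - a k) ^+ m k + expR (- (e * c k))).
  rewrite -[X in _ --> X]addr0; apply: cvgD; last exact: cvg_expRN_cst.
  by apply: cvgB => //; exact: cvg_cst.
near=> k.
have c0 : 0 < c k by near: k; exact: (cvgry_gt c_oo).
have mk : (0 < m k)%N by near: k.
have ak : 0 < a k < 1 by near: k.
have meank : (s + z) / 2 <= pills_mean (m k) (n k) (a k) / c k.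
  near: k; apply: (cvgr_ge _ mean_cvg); lra.
rewrite /F -{1}(prednK mk).
have t01 : 0 <= t < 1 by lra.
apply: le_trans (pills_lower_tail _ _ _ ak t01) _; rewrite (prednK mk) lerD2l.
apply: le_trans (lower_tail_exp (y := c k * x) _ _ ak t01 _) _.
  by rewrite truncn_le// mulr_ge0// ltW.
rewrite ler_expR lerN2 /e -mulrA ler_pM2l// -(mulrA (c k)) -/z.
move: meank; rewrite ler_pdivlMr//; lra.
Unshelve. all: by end_near. Qed.

(** As above, with t chosen such that x/(1+t) > s; the bound 4/(z-s) on c_k
    absorbs the rounding of the threshold to an integer. *)
Lemma upper_tail_cvg x : s < x -> 0 < s -> exists2 U : nat -> R,
  U @ \oo --> 1 - L & \forall k \near \oo, U k <= F k x.
Proof.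
move=> sx s0.
(* again x / (1 + t) is the harmonic mean of x and s *)
pose t := (x - s) / (2 * s).
have t0 : 0 < t by rewrite divr_gt0//; lra.
pose z := x / (1 + t).
have zs : s < z.
  rewrite /z ltr_pdivlMr; last lra.
  have -> : s * (1 + t) = (s + x) / 2 by rewrite /t; field; rewrite gt_eqF.
  lra.
pose e := t * ((z - s) / 4); have e0 : 0 < e by rewrite mulr_gt0//; lra.
exists (fun k => 1 - (1 - a k) ^+ m k - expR (- (e * c k))).
  rewrite -[X in _ --> X]subr0; apply: cvgB; last exact: cvg_expRN_cst.
  by apply: cvgB => //; exact: cvg_cst.
near=> k.
have c0 : 0 < c k by near: k; exact: (cvgry_gt c_oo).
have mk : (0 < m k)%N by near: k.
have ak : 0 < a k < 1 by near: k.
have ck : 4 / (z - s) <= c k by near: k; exact: (cvgry_ge c_oo).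
have meank : pills_mean (m k) (n k) (a k) / c k <= (s + z) / 2.
  near: k; apply: (cvgr_le _ mean_cvg); lra.
rewrite /F -(prednK mk).
have := pills_upper_tail (m k).-1 (n k) (Num.truncn (c k * x)) ak (ltW t0).
rewrite (prednK mk) => tail.
have yK : c k * x <= (Num.truncn (c k * x))%:R + 1.
  by rewrite natr1 ltW// truncnS_gt.
have := upper_tail_exp (m k) (n k) ak (ltW t0) yK.
have : expR (- (t * ((c k * x - 1) / (1 + t) - pills_mean (m k) (n k) (a k)))) <=
    expR (- (e * c k)).
  rewrite ler_expR lerN2 /e -mulrA ler_pM2l//.
  have zE : (c k * x - 1) / (1 + t) >= c k * z - 1.
    rewrite mulrBl -mulrA -/z lerD2l lerN2 div1r invf_le1; lra.
  move: ck meank; rewrite ler_pdivrMr ?subr_gt0// ler_pdivrMr//; lra.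
lra.
Unshelve. all: by end_near. Qed.

End TailLimits.

(** The tail bounds compare F k with G at points s other than x; letting s tend
    to x is where continuity of the limit at x enters. *)
Lemma cvg_sandwich (F : nat -> R) (G : R -> R) x : {for x, continuous G} ->
  (forall s, x < s -> exists2 U : nat -> R,
     U @ \oo --> G s & \forall k \near \oo, F k <= U k) ->
  (forall s, s < x -> exists2 U : nat -> R,
     U @ \oo --> G s & \forall k \near \oo, U k <= F k) ->
  F @ \oo --> G x.
Proof.
move=> cG up lo; apply/cvgrPdist_le => e e0.
have e20 : 0 < e / 2 by lra.
have [dlt /= d0 dG] : \forall y \near x, `|G x - G y| < e / 2.
  by move/cvgrPdist_lt : cG; exact.
have near_G (y : R) : `|x - y| < dlt -> `|G x - G y| < e / 2 by exact: dG.
have [U UG FU] := up (x + dlt / 2) ltac:(lra).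
have [V VG VF] := lo (x - dlt / 2) ltac:(lra).
have Gs : `|G x - G (x + dlt / 2)| < e / 2.
  by apply: near_G; rewrite opprD addNKr normrN gtr0_norm; lra.
have Gi : `|G x - G (x - dlt / 2)| < e / 2.
  by apply: near_G; rewrite opprB addrC subrK gtr0_norm; lra.
near=> k.
have FUk : F k <= U k by near: k.
have VFk : V k <= F k by near: k.
have UGk : `|G (x + dlt / 2) - U k| < e / 2 by near: k; move/cvgrPdist_lt : UG; exact.
have VGk : `|G (x - dlt / 2) - V k| < e / 2 by near: k; move/cvgrPdist_lt : VG; exact.
move: Gs Gi UGk VGk; rewrite !ltr_norml => /andP[? ?] /andP[? ?] /andP[? ?] /andP[? ?].
by rewrite ler_norml; apply/andP; split; lra.
Unshelve. all: by end_near. Qed.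
End Limits.
(** * Convergence in distribution for the urn *)

Section UrnLaw.
Context d (T : measurableType d) (R : realType) (P : probability T R).
Variables (S : nat -> {RV P >-> (nat * nat)%type}) (m n : nat).
Hypothesis SP : pills_process P m n S.
Local Notation h := (@pills_poly R).
Local Notation X := (remaining P S).

Lemma remaining_le_law K : P [set w | (X w <= K)%N] = (head_sum (h m n) K)%:E.
Proof.
elim: K => [|K IHK].
  rewrite /head_sum big_ord1 -(remaining_law SP 0); congr (P _).
  by apply/seteqP; split => w /=; rewrite leqn0 => /eqP.
have -> : [set w | (X w <= K.+1)%N] = [set w | (X w <= K)%N] `|` [set w | X w = K.+1].
  apply/seteqP; split => w /=; last by move=> [/leqW|->].
  by rewrite leq_eqVlt ltnS => /predU1P[]; [right|left].
have -> : (P ([set w | (X w <= K)%N] `|` [set w | X w = K.+1]) =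
    P [set w | (X w <= K)%N] + P [set w | X w = K.+1])%E.
  apply: measureU.
  - exact: (measurable_remaining_set S [set k | (k <= K)%N]).
  - exact: (measurable_remaining_set S [set K.+1]).
  - by apply/seteqP; split => w //= [XK XK1]; rewrite XK1 ltnn in XK.
by rewrite IHK (remaining_law SP) /head_sum [in RHS]big_ord_recr.
Qed.

Lemma cdf_remaining (c x : R) : 0 < c ->
  @cdf _ _ _ P (scaled P X c) x =
  (if 0 <= x then head_sum (h m n) (Num.truncn (c * x)) else 0)%:E.
Proof.
move=> c0; have -> : @cdf _ _ _ P (scaled P X c) x = P [set w | (X w)%:R <= c * x].
  rewrite /cdf /distribution /pushforward; congr (P _).
  by apply/seteqP; split => w /=; rewrite /scaled in_itv/= ler_pdivrMr// mulrC.
case: ifPn => x0; last first.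
  rewrite [X in P X](_ : _ = set0) ?measure0//; apply/seteqP; split => w //=.
  by move=> /(le_trans (ler0n _ _)); rewrite pmulr_rge0// (negbTE x0).
rewrite -remaining_le_law; congr (P _); apply/seteqP; split => w /=.
  by rewrite -truncn_ge_nat// mulr_ge0// ltW.
by rewrite truncn_ge_nat// mulr_ge0// ltW.
Qed.

(** The generating series has finitely many nonzero terms. *)
Lemma pgf_remaining v :
  cvgn (series (pgf_term P X v)) /\ pgf P X v = (h m n).[v].
Proof.
have H : series (pgf_term P X v) @ \oo --> (h m n).[v].
  have E : \forall N \near \oo, (h m n).[v] = series (pgf_term P X v) N.
    near=> N; rewrite (@horner_coef_wide _ N); last by near: N; exact: nbhs_infty_ge.
    rewrite -(big_mkord xpredT (fun i => (h m n)`_i * v ^+ i)) /series/=.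
    by apply: eq_bigr => k _; rewrite /pgf_term (remaining_law SP).
  exact: cvg_trans (near_eq_cvg E) (cvg_cst _).
by split; [apply/cvg_ex; exists (h m n).[v]|exact: cvg_lim H].
Unshelve. all: by end_near. Qed.

End UrnLaw.

(** A limit theorem covering both regimes.  The threshold [a] has to be tuned to
    every positive level s, with (1-a)^m tending to the survival function of
    the limit.  The relaxation s' <= s is for a limit with bounded support:
    beyond its right end point b the thresholds approach 1, the mean stays near
    b times the scale, and there G s = 1. *)
Lemma pills_cvg_in_distribution (R : realType) (m n : nat -> nat) (c : nat -> R)
    (d : nat -> measure_display) (T : forall k, measurableType (d k))
    (P : forall k, probability (T k) R)
    (S : forall k, nat -> {RV (P k) >-> (nat * nat)%type})
    (mu : set R -> \bar R) (G : R -> R) :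
  (\forall k \near \oo, (0 < m k)%N) ->
  (\forall k \near \oo, pills_process (P k) (m k) (n k) (S k)) ->
  c @ \oo --> +oo ->
  (forall y, mu `]-oo, y]%classic = (G y)%:E) ->
  (forall s : R, s <= 0 -> G s = 0) ->
  (forall s : R, 0 < s -> exists (a : nat -> R) (s' : R),
    [/\ 0 < s' <= s, s' = s \/ G s = 1, \forall k \near \oo, 0 < a k < 1,
        (1 - a k) ^+ m k @[k --> \oo] --> 1 - G s &
        pills_mean (m k) (n k) (a k) / c k @[k --> \oo] --> s']) ->
  cvg_in_distribution P (fun k => scaled (P k) (remaining (P k) (S k)) (c k)) mu.
Proof.
move=> m_gt0 SP c_oo muE G0 Glim x cmu.
have cG : {for x, continuous G}.
  have muG : (fun y : R => mu `]-oo, y]%classic) = EFin \o G by apply/funext.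
  by move: cmu; rewrite muG => /fine_cvgP[_].
pose F k : R :=
  if 0 <= x then head_sum (pills_poly R (m k) (n k)) (Num.truncn (c k * x)) else 0.
have FE : \forall k \near \oo,
    (F k)%:E = @cdf _ _ _ (P k) (scaled (P k) (remaining (P k) (S k)) (c k)) x.
  near=> k; have c0 : 0 < c k by near: k; exact: (cvgry_gt c_oo).
  by rewrite (@cdf_remaining _ _ _ _ _ (m k) (n k))//; near: k.
apply: (cvg_trans (near_eq_cvg FE)); rewrite muE; apply: cvg_EFin; first by near=> k.
rewrite /comp /= /F; have [x0|x0] := leP 0 x; last first.
  by rewrite G0 ?ltW//; exact: cvg_cst.
apply: cvg_sandwich => // s xs.
  have s0 : 0 < s by lra.
  have [a [s' [_ [s's|G1] a01 aG mean]]] := Glim s s0.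
    have [|U U1 FU] := lower_tail_cvg c_oo m_gt0 a01 aG mean (x := x).
      by rewrite x0 s's.
    by exists U => //; move: U1; rewrite opprB addrC subrK.
  exists (fun=> 1); first by rewrite G1; exact: cvg_cst.
  near=> k; have mk : (0 < m k)%N by near: k.
  rewrite -(horner1_pills_poly (m k).-1 (n k)) prednK// head_sum_le// => i.
  exact: pills_poly_ge0.
have [s0|s0] := leP s 0.
  exists (fun=> 0); first by rewrite G0//; exact: cvg_cst.
  by near=> k; rewrite head_sum_ge0// => i; exact: pills_poly_ge0.
have [a [s' [/andP[s'0 s's] _ a01 aG mean]]] := Glim s s0.
have [||U U1 FU] := upper_tail_cvg c_oo m_gt0 a01 aG mean (x := x) => //.
  exact: le_lt_trans xs.
by exists U => //; move: U1; rewrite opprB addrC subrK.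
Unshelve. all: by end_near. Qed.

(** * The two limit laws and their scales *)

Section LimitLaws.
Context {R : realType}.
Implicit Types (s y : R).

Lemma cvg_invn : (k%:R^-1 : R) @[k --> \oo] --> (0 : R).
Proof.
apply/gtr0_cvgV0; last exact: cvgr_idn.
by near=> k; rewrite ltr0n; near: k; exact: nbhs_infty_gt.
Unshelve. all: by end_near. Qed.

Lemma cvg_ln_idn : (ln k%:R : R) @[k --> \oo] --> +oo.
Proof.
apply/cvgryPge => A; near=> k.
have Ak : expR A <= k%:R by near: k; exact: nbhs_infty_ger.
by rewrite -ler_expR lnK// posrE (lt_le_trans (expR_gt0 A)).
Unshelve. all: by end_near. Qed.

Lemma cvg_onem_divn s : 0 < s -> (1 - s / k%:R) ^+ k @[k --> \oo] --> expR (- s).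
Proof.
move=> s0.
have sk0 : s / k%:R @[k --> \oo] --> (0 : R).
  by rewrite -[X in _ --> X](mulr0 s); apply: cvgM; [exact: cvg_cst|exact: cvg_invn].
have sk1 : 1 - s / k%:R @[k --> \oo] --> (1 : R).
  by rewrite -[X in _ --> X]subr0; apply: cvgB => //; exact: cvg_cst.
have kln : k%:R * ln (1 - s / k%:R) @[k --> \oo] --> - s.
  apply: (@squeeze_cvgr _ _ _ _ (fun k => - (s * (1 - s / k%:R)^-1)) (fun=> - s)).
  - near=> k.
    have k0 : 0 < k%:R :> R by rewrite ltr0n; near: k; exact: nbhs_infty_gt.
    have p0 : 0 < 1 - s / k%:R by near: k; apply: (cvgr_gt _ sk1); lra.
    have kE : k%:R * (s / k%:R) = s by field; rewrite gt_eqF.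
    apply/andP; split.
      have := ln_ge_oneBV p0; rewrite -(ler_pM2l k0); apply: le_trans.
      rewrite le_eqVlt; apply/orP; left; apply/eqP.
      rewrite -{1}kE; set p := 1 - _ in p0 *.
      have -> : s / k%:R = 1 - p by rewrite /p; ring.
      by field; rewrite gt_eqF.
    have := @le_ln1Dx R (- (s / k%:R)) ltac:(lra); rewrite -(ler_pM2l k0) mulrN kE.
    by [].
  - rewrite -[X in _ --> X]opprK; apply: cvgN; rewrite opprK -[X in _ --> X]mulr1.
    apply: cvgM; first exact: cvg_cst.
    by rewrite -[X in _ --> X]invr1; apply: cvgV; rewrite ?oner_neq0.
  - exact: cvg_cst.
have E : \forall k \near \oo, expR (k%:R * ln (1 - s / k%:R)) = (1 - s / k%:R) ^+ k.
  near=> k; rewrite expRM_natl lnK// posrE.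
  by near: k; apply: (cvgr_gt _ sk1); lra.
apply: (cvg_trans (near_eq_cvg E)).
by apply: cvg_comp kln _; exact: continuous_expR.
Unshelve. all: by end_near. Qed.

Lemma integral_support (f : R -> R) (A B : set R) : B `<=` A ->
  (forall x, A x -> ~ B x -> f x = 0) ->
  (\int[@lebesgue_measure R]_(x in A) (f x)%:E =
   \int[@lebesgue_measure R]_(x in B) (f x)%:E)%E.
Proof.
move=> BA f0; rewrite [LHS]integral_mkcond [RHS]integral_mkcond.
apply: eq_integral => x _; rewrite !patchE.
case: (pselect (B x)) => Bx; first by rewrite !mem_set//; exact: BA.
rewrite (memNset Bx); case: (pselect (A x)) => Ax; last by rewrite memNset.
by rewrite mem_set// f0.
Qed.

Lemma exponential_prob_cdf y :
  exponential_prob (1 : R) `]-oo, y]%classic = (if 0 <= y then 1 - expR (- y) else 0)%:E.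
Proof.
have -> : exponential_prob (1 : R) `]-oo, y]%classic =
    exponential_prob (1 : R) `[0, y]%classic.
  apply: integral_support => x /=; rewrite !in_itv/=; first by move=> /andP[].
  move=> -> /negP; rewrite andbT -ltNge; exact: lt0_exponential_pdf.
have [] := ltgtP 0 y => [y0|y0|<-].
- by rewrite exponential_prob_itv0c// mulN1r.
- by rewrite /exponential_prob set_itv_ge ?integral_set0// bnd_simp -ltNge.
- by rewrite /exponential_prob set_itv1 integral_set1 oppr0 expR0 subrr.
Qed.

Lemma beta_prob_cdf m y : (0 < m)%N ->
  beta_prob 1 m `]-oo, y]%classic =
  (if 0 <= y then 1 - (1 - Num.min y 1) ^+ m else 0 : R)%:E.
Proof.
move=> m0; rewrite -integral_beta_pdf//.
have -> : (\int[lebesgue_measure]_(x in `]-oo, y]) (beta_pdf 1 m x)%:E =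
    \int[lebesgue_measure]_(x in `[0%R, (Num.min y 1)%R]) (beta_pdf 1 m x : R)%:E)%E.
  apply: integral_support => x /=; rewrite !in_itv/= le_min.
    by move=> /and3P[].
  move=> -> /negP xN; rewrite /beta_pdf patchE memNset ?mul0r//= in_itv/=; exact/negP.
have [y0|y0] := leP 0 y; last first.
  by rewrite set_itv_ge ?integral_set0// bnd_simp -ltNge gt_min y0.
have bE : beta_fun 1 m = m%:R^-1 :> R.
  rewrite beta_funE (gtn_eqF m0)/= fact0 mul1r; case: (m) m0 => // j _.
  by rewrite factS natrM invfM mulrCA divff ?mulr1// pnatr_eq0 -lt0n fact_gt0.
set w := Num.min y 1.
have w1 : w <= 1 by rewrite ge_min lexx orbT.
have [w0|w0] := leP w 0.
  have -> : w = 0 by apply/eqP; rewrite eq_le w0 le_min y0 ler01.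
  by rewrite set_itv1 integral_set1 subr0 expr1n subrr.
transitivity (\int[@lebesgue_measure R]_(x in `[0%R, w]) (m%:R * (1 - x) ^+ m.-1)%:E)%E.
  apply: eq_integral => x; rewrite inE/= in_itv/= => /andP[x0 xw].
  rewrite /beta_pdf patchE mem_set/=; last by rewrite in_itv/= x0 (le_trans xw).
  by rewrite bE invrK /XMonemX expr0 mul1r mulrC.
have cm : continuous (fun x : R => m%:R * (1 - x) ^+ m.-1).
  by move=> x; apply: cvgM; [exact: cvg_cst|exact: continuous_onemX].
rewrite -[LHS]fineK; last exact/integrable_fin_num/integrable_continuous.
congr EFin; rewrite -/(Rintegral _ _ _) RintegralZl//; last first.
  exact/integrable_continuous/continuous_onemX.
by rewrite -{1}(prednK m0) Rintegral_onemX// prednK// subr0 expr1n.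
Qed.

(** For a = s/k, the contribution of the double-unit pills is
    s ln k (1 + o(1)), and that of the single-unit pills is exactly s n/k.  As
    n >= 0 is arbitrary, the error is compared with ln k, which is at most the
    whole scale. *)
Lemma exponential_scaling (n : nat -> nat) s : 0 < s ->
  pills_mean k (n k) (s / k%:R) / ((n k)%:R / k%:R + ln k%:R) @[k --> \oo] --> s.
Proof.
move=> s0.
have sk0 : s / k%:R @[k --> \oo] --> (0 : R).
  by rewrite -[X in _ --> X](mulr0 s); apply: cvgM; [exact: cvg_cst|exact: cvg_invn].
have lnV0 : (ln k%:R : R)^-1 @[k --> \oo] --> (0 : R).
  apply/gtr0_cvgV0; last exact: cvg_ln_idn.
  by near=> k; near: k; exact: (cvgry_gt cvg_ln_idn).
pose D k := s * ((1 - k%:R^-1) / (1 - s / k%:R) * (1 - ln s / ln k%:R)) - s.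
have D0 : D k @[k --> \oo] --> (0 : R).
  rewrite -[X in _ --> X](subrr s); apply: cvgB; last exact: cvg_cst.
  rewrite -[X in _ --> X]mulr1; apply: cvgM; first exact: cvg_cst.
  rewrite -[X in _ --> X]mulr1; apply: cvgM.
    rewrite -[X in _ --> X]mulr1; apply: cvgM.
      by rewrite -[X in _ --> X]subr0; apply: cvgB; [exact: cvg_cst|exact: cvg_invn].
    rewrite -[X in _ --> X]invr1; apply: cvgV; first exact: oner_neq0.
    by rewrite -[X in _ --> X]subr0; apply: cvgB; [exact: cvg_cst|].
  rewrite -[X in _ --> X]subr0; apply: cvgB; first exact: cvg_cst.
  by rewrite -[X in _ --> X](mulr0 (ln s)); apply: cvgM; [exact: cvg_cst|].
have bound : \forall k \near \oo,
    `|pills_mean k (n k) (s / k%:R) / ((n k)%:R / k%:R + ln k%:R) - s| <= `|D k|.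
  near=> k.
  have kn : (0 < k)%N by near: k; exact: nbhs_infty_gt.
  have k0 : 0 < k%:R :> R by rewrite ltr0n.
  have lnk0 : 0 < ln k%:R :> R by near: k; exact: (cvgry_gt cvg_ln_idn).
  have sk1 : s / k%:R < 1 by near: k; apply: (cvgr_lt _ sk0).
  have ks : s < k%:R by move: sk1; rewrite ltr_pdivrMr// mul1r.
  have nk0 : 0 <= (n k)%:R / k%:R :> R by rewrite divr_ge0.
  set c := _ + ln _; have c0 : 0 < c by rewrite /c; lra.
  have -> : pills_mean k (n k) (s / k%:R) / c - s = D k * (ln k%:R / c).
    rewrite /pills_mean /half_survival /D ln_div ?posrE// /c.
    have -> : k.-1%:R = k%:R - 1 :> R by rewrite -{2}(prednK kn) -natr1 addrK.
    field; rewrite !gt_eqF//; try lra.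
    by rewrite ltr_wpDl// mulr_gt0.
  rewrite normrM ler_piMr// ger0_norm ?divr_ge0 ?(ltW lnk0) ?(ltW c0)//.
  rewrite ler_pdivrMr// mul1r /c; lra.
apply/cvgrPdist_le => e e0; near=> k.
have De : `|D k| <= e by near: k; move/cvgr0Pnorm_le : D0; apply.
by rewrite distrC (le_trans _ De)//; near: k; exact: bound.
Unshelve. all: by end_near. Qed.

(** A fixed number of double-unit pills contributes a bounded amount. *)
Lemma beta_scaling m (a : nat -> R) s : (\forall k \near \oo, 0 < a k < 1) ->
  a @ \oo --> s -> pills_mean m k (a k) / k%:R @[k --> \oo] --> s.
Proof.
move=> a01 a_s.
have b0 : m.-1%:R * k%:R^-1 @[k --> \oo] --> (0 : R).
  by rewrite -[X in _ --> X](mulr0 m.-1%:R); apply: cvgM;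
    [exact: cvg_cst|exact: cvg_invn].
apply: (@squeeze_cvgr _ _ _ _ a (fun k => a k + m.-1%:R * k%:R^-1)) => //.
  near=> k; have k0 : 0 < k%:R :> R by rewrite ltr0n; near: k; exact: nbhs_infty_gt.
  have ak : 0 < a k < 1 by near: k.
  have /andP[r0 r1] := half_survival_itv ak.
  have -> : pills_mean m k (a k) / k%:R = a k + m.-1%:R * k%:R^-1 * half_survival (a k).
    by rewrite /pills_mean; field; rewrite gt_eqF.
  have mk0 : 0 <= m.-1%:R * k%:R^-1 :> R by rewrite mulr_ge0// invr_ge0 ltW.
  by rewrite lerDl lerD2l mulr_ge0//= ler_piMr.
by rewrite -[X in _ --> X]addr0; apply: cvgD.
Unshelve. all: by end_near. Qed.

End LimitLaws.
Theorem theorem1 (R : realType) :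
  (* (i) *)
  (forall (m n : nat) (d : measure_display) (T : measurableType d)
      (P : probability T R) (S : nat -> {RV P >-> (nat * nat)%type}),
    (1 <= m)%N -> pills_process P m n S ->
    forall v : R,
      cvgn (series (pgf_term P (remaining P S) v)) /\
      pgf P (remaining P S) v =
        m%:R * v * \int[lebesgue_measure]_(q in `[0, 1])
          ((1 + (v - 1) * q) ^+ n
           * (1 - q - (v - 1) * q * ln q) ^+ (m - 1)))
  /\
  (* (ii) *)
  (forall (n : nat -> nat) (d : nat -> measure_display)
      (T : forall m, measurableType (d m)) (P : forall m, probability (T m) R)
      (S : forall m, nat -> {RV (P m) >-> (nat * nat)%type}),
    (forall m, (1 <= m)%N -> pills_process (P m) m (n m) (S m)) ->
    cvg_in_distribution P
      (fun m => scaled (P m) (remaining (P m) (S m)) ((n m)%:R / m%:R + ln m%:R))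
      (exponential_prob (1 : R)))
  /\
  (* (iii) *)
  (forall (m : nat) (d : nat -> measure_display)
      (T : forall n, measurableType (d n)) (P : forall n, probability (T n) R)
      (S : forall n, nat -> {RV (P n) >-> (nat * nat)%type}),
    (1 <= m)%N -> (forall n, pills_process (P n) m n (S n)) ->
    cvg_in_distribution P
      (fun n => scaled (P n) (remaining (P n) (S n)) n%:R)
      (beta_prob 1 m)).

Proof.
split; [|split].
- move=> m n d T P S m0 SP v; have [cv ->] := pgf_remaining SP v; split=> //.
  by rewrite -(prednK m0) horner_pills_poly prednK// -subn1.
- move=> n d T P S SP.
  apply: (@pills_cvg_in_distribution R id n _ d T P S _
    (fun y => if 0 <= y then 1 - expR (- y) else 0)).
  + exact: nbhs_infty_gt.
  + by near=> k; apply: SP; near: k; exact: nbhs_infty_gt.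
  + apply/cvgryPge => A; near=> k; rewrite -[A]add0r lerD ?divr_ge0//.
    by near: k; exact: (cvgry_ge (@cvg_ln_idn R)).
  + exact: exponential_prob_cdf.
  + move=> s s0; case: ifPn => // s0'; have -> : s = 0 by apply/eqP; rewrite eq_le s0.
    by rewrite oppr0 expR0 subrr.
  + move=> s s0; exists (fun k => s / k%:R), s; split.
    * by rewrite s0 lexx.
    * by left.
    * near=> k; have k0 : 0 < k%:R :> R by rewrite ltr0n; near: k; exact: nbhs_infty_gt.
      rewrite divr_gt0// ltr_pdivrMr// mul1r; near: k; exact: nbhs_infty_gtr.
    * by rewrite ltW// opprB addrC subrK; exact: cvg_onem_divn.
    * exact: exponential_scaling.
- move=> m d T P S m0 SP.
  apply: (@pills_cvg_in_distribution R (fun=> m) id _ d T P S _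
    (fun y => if 0 <= y then 1 - (1 - Num.min y 1) ^+ m else 0)).
  + by near=> k.
  + by near=> k; exact: SP.
  + exact: cvgr_idn.
  + by move=> y; exact: beta_prob_cdf.
  + move=> s s0; case: ifPn => // s0'; have -> : s = 0 by apply/eqP; rewrite eq_le s0.
    by rewrite min_l// subr0 expr1n subrr.
  (* a tends to min s 1 but stays below 1; the shift by 2 keeps it positive *)
  + move=> s s0; set w := Num.min s 1.
    have w0 : 0 < w by rewrite lt_min s0 ltr01.
    have w1 : w <= 1 by rewrite ge_min lexx orbT.
    have aw : w * (1 - (k + 2)%:R^-1) @[k --> \oo] --> w.
      rewrite -[X in _ --> X]mulr1; apply: cvgM; first exact: cvg_cst.
      rewrite -[X in _ --> X]subr0; apply: cvgB; first exact: cvg_cst.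
      by have := @cvg_invn R; rewrite -(cvg_shiftn 2).
    have a01 : \forall k \near \oo, 0 < w * (1 - (k + 2)%:R^-1) < 1.
      near=> k; have k0 : 0 < (k + 2)%:R^-1 :> R by rewrite invr_gt0 addn2.
      have k1 : (k + 2)%:R^-1 < 1 :> R by rewrite addn2 invf_lt1// ltr1n.
      by apply/andP; split; nra.
    exists (fun k => w * (1 - (k + 2)%:R^-1)), w; split=> //.
    * by rewrite w0 ge_min lexx.
    * have [s1|s1] := leP s 1; [left|right]; first by rewrite /w min_l.
      by rewrite ltW// /w min_r ?ltW// subrr expr0n gtn_eqF// subr0.
    * rewrite ltW// opprB addrC subrK.
      have aw1 : 1 - w * (1 - (k + 2)%:R^-1) @[k --> \oo] --> 1 - w.
        by apply: cvgB => //; exact: cvg_cst.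
      apply: (@cvg_comp _ _ _ _ (fun x : R => x ^+ m) _ _ _ aw1).
      exact: exprn_continuous.
    * exact: beta_scaling.
Unshelve. all: by end_near. Qed.
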